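(* Let $k,n\ge1$. The $n$th power $I_k^n$ of the augmentation ideal $I_k$ of $\mathbb{Z}P_k$ is generated, as a $\mathbb{Z}$-module, by all $k$-strand pure braid diagrams with $n$ double points.
   Context: $B_k$ is the braid group on $k$ strands with standard generators $\sigma_1,\dots,\sigma_{k-1}$, and $P_k\subset B_k$ is the pure braid group (braids whose associated permutation is the identity). $I_k$ is the augmentation ideal of the integral group ring $\mathbb{Z}P_k$, i.e. the kernel of the ring map $\mathbb{Z}P_k\to\mathbb{Z}$ sending each group element to $1$. A double point in a braid diagram denotes the difference in $\mathbb{Z}B_k$ of the two braids obtained by replacing it with a positive crossing and with a negative crossing. Thus a $k$-strand braid diagram with $n$ double points represents an element of $\mathbb{Z}B_k$ of the form $w_1(\sigma_{i_1}-\sigma_{i_1}^{-1})w_2(\sigma_{i_2}-\sigma_{i_2}^{-1})\cdots w_n(\sigma_{i_n}-\sigma_{i_n}^{-1})w_{n+1}$ with $w_j\in B_k$. It is called pure if the braids obtained by resolving its double points are pure, so that this element lies in $\mathbb{Z}P_k$. *)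

(* Defs.v *)
From HB Require Import structures.
From mathcomp Require Import all_boot all_fingroup all_algebra.
From mathcomp Require Import finmap monalg.
From mathcomp Require Import boolp classical_sets.
From mathcomp Require Import zify.

Set Implicit Arguments.
Unset Strict Implicit.
Unset Printing Implicit Defensive.

Import GRing.Theory.
Local Open Scope classical_set_scope.
Local Open Scope ring_scope.

(* Words over X: the letter (x, true) stands for the generator x and
   (x, false) for its inverse. *)
Definition word (X : choiceType) := seq (X * bool).

HB.instance Definition _ X := Choice.on (word X).

(* [repr] alone is the coset representative of fingroup. *)
Local Notation qrepr := generic_quotient.repr.

Section Presentation.
Variables (X : choiceType) (R : word X -> word X -> Prop).

Inductive pres_eq : word X -> word X -> Prop :=
| pres_rel u v : R u v -> pres_eq u v
| pres_cancel x e : pres_eq [:: (x, e); (x, ~~ e)] [::]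
| pres_cat u u' v v' :
    pres_eq u u' -> pres_eq v v' -> pres_eq (u ++ v) (u' ++ v')
| pres_refl u : pres_eq u u
| pres_sym u v : pres_eq u v -> pres_eq v u
| pres_trans v u w : pres_eq u v -> pres_eq v w -> pres_eq u w.

Definition pres_eqb (u v : word X) : bool := `[< pres_eq u v >].

Lemma pres_eqb_equiv : equiv_class_of pres_eqb.
Proof.
split=> [u|u v|v u w]; first exact/asboolP/pres_refl.
  by apply/asboolP/asboolP; exact: pres_sym.
by move=> /asboolP uv /asboolP vw; apply/asboolP/(pres_trans uv).
Qed.

Canonical pres_equiv := EquivRelPack pres_eqb_equiv.

Definition presented := {eq_quot pres_equiv}%qT.

HB.instance Definition _ := Choice.on presented.

Definition pres_class (u : word X) : presented := (\pi u)%qT.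

Lemma pres_classP u v : pres_class u = pres_class v <-> pres_eq u v.
Proof.
split=> [/eqP|/asboolP uv]; first by rewrite eqmodE => /asboolP.
by apply/eqP; rewrite eqmodE.
Qed.

Lemma pres_reprK (g : presented) : pres_class (qrepr g) = g.
Proof. exact: reprK. Qed.

Lemma pres_repr u : pres_eq (qrepr (pres_class u)) u.
Proof. exact/pres_classP/pres_reprK. Qed.

Definition word_inv (u : word X) : word X :=
  rev [seq (l.1, ~~ l.2) | l <- u].

Lemma word_invK u : word_inv (word_inv u) = u.
Proof.
rewrite /word_inv -map_rev revK -map_comp -[RHS]map_id.
by apply: eq_map => -[x e] /=; rewrite negbK.
Qed.

Lemma word_mulV u : pres_eq (u ++ word_inv u) [::].
Proof.
elim: u => [|[x e] u IHu]; first exact: pres_refl.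
rewrite /word_inv /= rev_cons -cats1 -cat_cons catA -cat1s -/(word_inv u) -catA.
rewrite -catA (catA u).
apply: pres_trans (pres_cancel x e).
apply: (pres_cat (u := [:: (x, e)]) (pres_refl _)).
exact: (pres_cat (u' := [::]) IHu (pres_refl _)).
Qed.

Lemma word_inv_eq u v : pres_eq u v -> pres_eq (word_inv u) (word_inv v).
Proof.
move=> uv.
have h1 : pres_eq (word_inv u ++ v ++ word_inv v) (word_inv u).
  rewrite -[X in pres_eq _ X]cats0.
  by apply: pres_cat; [exact: pres_refl | exact: word_mulV].
have h2 : pres_eq (word_inv u ++ v ++ word_inv v) (word_inv v).
  rewrite catA; apply: (pres_cat (u' := [::])); last exact: pres_refl.
  apply: (@pres_trans (word_inv u ++ u)).
    by apply: pres_cat; [exact: pres_refl | exact: pres_sym].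
  by rewrite -{2}(word_invK u); exact: word_mulV.
exact: pres_trans (pres_sym h1) h2.
Qed.

Definition pres_mul (g h : presented) := pres_class (qrepr g ++ qrepr h).
Definition pres_inv (g : presented) := pres_class (word_inv (qrepr g)).

Lemma pres_mulE u v :
  pres_mul (pres_class u) (pres_class v) = pres_class (u ++ v).
Proof. by apply/pres_classP/pres_cat; exact: pres_repr. Qed.

Lemma pres_invE u : pres_inv (pres_class u) = pres_class (word_inv u).
Proof. exact/pres_classP/word_inv_eq/pres_repr. Qed.

Lemma pres_mulA : associative pres_mul.
Proof.
move=> a b c; rewrite -(pres_reprK a) -(pres_reprK b) -(pres_reprK c).
by rewrite !pres_mulE catA.
Qed.

Lemma pres_1mul : left_id (pres_class [::]) pres_mul.
Proof. by move=> a; rewrite -(pres_reprK a) pres_mulE. Qed.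

Lemma pres_mul1 : right_id (pres_class [::]) pres_mul.
Proof. by move=> a; rewrite -(pres_reprK a) pres_mulE cats0. Qed.

Lemma pres_mulV : right_inverse (pres_class [::]) pres_inv pres_mul.
Proof.
move=> a; rewrite -(pres_reprK a) pres_invE pres_mulE.
exact/pres_classP/word_mulV.
Qed.

Lemma pres_Vmul : left_inverse (pres_class [::]) pres_inv pres_mul.
Proof.
move=> a; rewrite -(pres_reprK a) pres_invE pres_mulE.
apply/pres_classP; rewrite -{2}(word_invK (qrepr a)); exact: word_mulV.
Qed.

HB.instance Definition _ := isGroup.Build presented
  pres_mulA pres_1mul pres_mul1 pres_Vmul pres_mulV.

Definition pres_gen (x : X) : presented := pres_class [:: (x, true)].

Section Lift.
Variables (H : groupType) (f : X -> H).

Definition word_eval (u : word X) : H :=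
  (\prod_(l <- u) (if l.2 then f l.1 else (f l.1)^-1))%g.

Definition pres_lift (g : presented) : H := word_eval (qrepr g).

Hypothesis fR : forall u v, R u v -> word_eval u = word_eval v.

Lemma word_eval_eq u v : pres_eq u v -> word_eval u = word_eval v.
Proof.
rewrite /word_eval; elim=> {u v}.
- exact: fR.
- by move=> x [] /=; rewrite !big_cons big_nil mulg1 ?mulgV ?mulVg.
- by move=> u u' v v' _ IH1 _ IH2; rewrite !big_cat /= IH1 IH2.
- by [].
- by [].
- by move=> v u w _ -> _ ->.
Qed.

Lemma pres_lift_class u : pres_lift (pres_class u) = word_eval u.
Proof. exact/word_eval_eq/pres_repr. Qed.

Lemma pres_liftM : {morph pres_lift : g h / (g * h)%g}.
Proof.
move=> g h; rewrite {1}/pres_lift (word_eval_eq (pres_repr _)).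
by rewrite /word_eval big_cat.
Qed.

Lemma pres_lift_gen x : pres_lift (pres_gen x) = f x.
Proof. by rewrite pres_lift_class /word_eval big_cons big_nil /= mulg1. Qed.
End Lift.
End Presentation.

Inductive braid_rel (k : nat) : word 'I_k.-1 -> word 'I_k.-1 -> Prop :=
| braid_far (i j : 'I_k.-1) : (i.+1 < j)%N ->
    braid_rel [:: (i, true); (j, true)] [:: (j, true); (i, true)]
| braid_adj (i j : 'I_k.-1) : j = i.+1 :> nat ->
    braid_rel [:: (i, true); (j, true); (i, true)]
              [:: (j, true); (i, true); (j, true)].

Definition braid (k : nat) := presented (@braid_rel k).
HB.instance Definition _ k := Group.on (braid k).

(* Indices start at 0: sigma i is the generator usually written sigma_(i+1). *)
Definition sigma k (i : 'I_k.-1) : braid k := pres_gen (@braid_rel k) i.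

Lemma ltn_strand k (i : 'I_k.-1) : (i.+1 < k)%N.
Proof. by rewrite -ltn_predRL. Qed.

Definition strand k (i : 'I_k.-1) : 'I_k := Ordinal (ltnW (ltn_strand i)).
Definition next_strand k (i : 'I_k.-1) : 'I_k := Ordinal (ltn_strand i).

Definition braid_perm k : braid k -> 'S_k :=
  pres_lift (fun i => tperm (strand i) (next_strand i)).

Lemma val_tperm_strand k (i : 'I_k.-1) (x : 'I_k) :
  tperm (strand i) (next_strand i) x =
    (if x == i :> nat then i.+1 else if x == i.+1 :> nat then i : nat else x)
  :> nat.
Proof.
case: tpermP => [->|->|/eqP+ /eqP+] /=; rewrite -?val_eqE /=.
- by rewrite eqxx.
- by rewrite eqxx gtn_eqF.
- by move=> /negPf-> /negPf->.
Qed.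

Lemma braid_perm_rel k u v : @braid_rel k u v ->
  word_eval (fun i => tperm (strand i) (next_strand i)) u =
  word_eval (fun i => tperm (strand i) (next_strand i)) v.
Proof.
case=> i j ij; rewrite /word_eval !big_cons !big_nil /= !mulg1;
  apply/permP => x; apply/val_inj; rewrite !permM /= !val_tperm_strand.
- by do !case: ifPn; lia.
- by rewrite ij; do !case: ifPn; lia.
Qed.

Lemma braid_permM k : {morph @braid_perm k : g h / (g * h)%g}.
Proof. exact/pres_liftM/braid_perm_rel. Qed.

Lemma braid_perm1 k : @braid_perm k 1%g = 1%g.
Proof. by apply: (mulgI (braid_perm 1%g)); rewrite -braid_permM !mulg1. Qed.

HB.instance Definition _ k :=
  isUMagmaMorphism.Build (braid k) 'S_k (@braid_perm k)
    (conj (@braid_perm1 k) (@braid_permM k)).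

Lemma braid_perm_sigma k (i : 'I_k.-1) :
  braid_perm (sigma i) = tperm (strand i) (next_strand i).
Proof. exact/pres_lift_gen/braid_perm_rel. Qed.

Definition is_pure k : {pred braid k} := fun b => braid_perm b == 1%g.

Lemma is_pure_closed k : group_closed (@is_pure k).
Proof.
split=> [|b c]; first by rewrite unfold_in braid_perm1.
rewrite !unfold_in => /eqP pb /eqP pc.
have pV : braid_perm c^-1%g = 1%g.
  by rewrite -[LHS]mul1g -pc -braid_permM mulgV braid_perm1.
by rewrite braid_permM pb pV mulg1.
Qed.

Record pure_braid (k : nat) :=
  PureBraid { pure_val : braid k; _ : pure_val \in @is_pure k }.

HB.instance Definition _ k := [isSub for @pure_val k].
HB.instance Definition _ k := [Choice of pure_braid k by <:].
HB.instance Definition _ k :=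
  SubChoice_isSubGroup.Build (braid k) (@is_pure k) (pure_braid k)
    (@is_pure_closed k).

(* Only the additive structure of {malg int[G]} is reused: the product of
   monalg is for monoids without nontrivial units. *)
Definition groupRing (G : groupType) := {malg int[G]}.
HB.instance Definition _ G := GRing.Zmodule.on (groupRing G).

Definition gr_of (G : groupType) (g : G) : groupRing G := << g >>.

Section GroupRingLin.
Variables (G : groupType) (V : zmodType).
Implicit Types (f : G -> V) (x y : groupRing G).

(* The additive extension of f to the group ring. *)
Definition gr_lin f x : V := \sum_(g <- msupp x) f g *~ x@_g.

Lemma gr_linEw f x (d : {fset G}) : (msupp x `<=` d)%fset ->
  gr_lin f x = \sum_(g <- d) f g *~ x@_g.
Proof.
move=> le; rewrite /gr_lin (big_fset_incl _ le) //= => g _ /mcoeff_outdom ->.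
by rewrite mulr0z.
Qed.

Lemma gr_linD f : {morph gr_lin f : x y / x + y}.
Proof.
move=> x y.
have lx : (msupp x `<=` msupp x `|` msupp y)%fset by exact: fsubsetUl.
have ly : (msupp y `<=` msupp x `|` msupp y)%fset by exact: fsubsetUr.
rewrite (gr_linEw _ (msuppD_le x y)) (gr_linEw _ lx) (gr_linEw _ ly).
by rewrite -big_split; apply: eq_bigr => g _; rewrite mcoeffD mulrzDr.
Qed.

Lemma gr_linB f : additive (gr_lin f).
Proof.
move=> x y; apply: (addIr (gr_lin f y)).
by rewrite -gr_linD !subrK.
Qed.

HB.instance Definition _ f :=
  GRing.isAdditive.Build (groupRing G) V (gr_lin f) (gr_linB f).

Lemma gr_lin_of f g : gr_lin f (gr_of g) = f g.
Proof.
rewrite (gr_linEw _ msuppU_le) (big_seq_fset1 _ g).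
by rewrite mcoeffUU mulr1z.
Qed.
End GroupRingLin.

Lemma gr_of_sum G (x : groupRing G) :
  x = \sum_(g <- msupp x) gr_of g *~ x@_g.
Proof.
rewrite {1}[x]monalgE; apply: eq_bigr => g _.
by rewrite -{1}[x@_g]intz raddfMz.
Qed.

Lemma raddf_gr G (V : zmodType) (f : {additive groupRing G -> V}) x :
  f x = \sum_(g <- msupp x) f (gr_of g) *~ x@_g.
Proof.
rewrite {1}[x]gr_of_sum raddf_sum.
by apply: eq_bigr => g _; rewrite raddfMz.
Qed.

Lemma gr_lin_ext G (V : zmodType) (f h : {additive groupRing G -> V}) :
  (forall g, f (gr_of g) = h (gr_of g)) -> f =1 h.
Proof.
by move=> fh x; rewrite !raddf_gr; apply: eq_bigr => g _; rewrite fh.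
Qed.

Section GroupRingMul.
Variable G : groupType.
Implicit Types x y z : groupRing G.

Definition gr_mul x y : groupRing G :=
  gr_lin (fun g => gr_lin (fun h => gr_of (g * h)%g) y) x.

Lemma gr_mulB_r x : additive (gr_mul x).
Proof.
move=> y z; rewrite /gr_mul /gr_lin -sumrB; apply: eq_bigr => g _.
by rewrite -/(gr_lin _ (y - z)) raddfB mulrzBl.
Qed.

HB.instance Definition _ x :=
  GRing.isAdditive.Build (groupRing G) (groupRing G) (gr_mul x) (gr_mulB_r x).

Definition gr_mulr y x := gr_mul x y.

Lemma gr_mulB_l y : additive (gr_mulr y).
Proof. by move=> x z; rewrite /gr_mulr /gr_mul raddfB. Qed.

HB.instance Definition _ y :=
  GRing.isAdditive.Build (groupRing G) (groupRing G) (gr_mulr y) (gr_mulB_l y).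

Lemma gr_mul_of g h : gr_mul (gr_of g) (gr_of h) = gr_of (g * h)%g.
Proof. by rewrite /gr_mul !gr_lin_of. Qed.

Lemma gr_mulA : associative gr_mul.
Proof.
move=> x y z; rewrite -[RHS]/((gr_mulr z \o gr_mulr y) x).
rewrite -[LHS]/(gr_mulr (gr_mul y z) x); apply: gr_lin_ext => g /=.
rewrite -[LHS]/((gr_mul (gr_of g) \o gr_mulr z) y).
rewrite -[RHS]/((gr_mulr z \o gr_mul (gr_of g)) y); apply: gr_lin_ext => h /=.
rewrite -[LHS]/((gr_mul (gr_of g) \o gr_mul (gr_of h)) z).
rewrite /gr_mulr gr_mul_of; apply: gr_lin_ext => k /=.
by rewrite !gr_mul_of mulgA.
Qed.

Lemma gr_1mul : left_id (gr_of 1%g) gr_mul.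
Proof.
move=> x; apply: (gr_lin_ext (f := gr_mul _) (h := idfun)) => g.
by rewrite /= gr_mul_of mul1g.
Qed.

Lemma gr_mul1 : right_id (gr_of 1%g) gr_mul.
Proof.
move=> x; apply: (gr_lin_ext (f := gr_mulr _) (h := idfun)) => g.
by rewrite /= /gr_mulr gr_mul_of mulg1.
Qed.

Lemma gr_mulDl : left_distributive gr_mul +%R.
Proof. by move=> x y z; rewrite -[LHS]/(gr_mulr z (x + y)) raddfD. Qed.

Lemma gr_mulDr : right_distributive gr_mul +%R.
Proof. by move=> x y z; rewrite raddfD. Qed.

Lemma gr_1neq0 : gr_of 1%g != 0 :> groupRing G.
Proof. by rewrite monalgU_eq0. Qed.

HB.instance Definition _ := GRing.Zmodule_isNzRing.Build (groupRing G)
  gr_mulA gr_1mul gr_mul1 gr_mulDl gr_mulDr gr_1neq0.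

Lemma gr_ofM (g h : G) : gr_of g * gr_of h = gr_of (g * h)%g.
Proof. exact: gr_mul_of. Qed.

Definition augmentation (x : groupRing G) : int := gr_lin (fun=> 1) x.

HB.instance Definition _ :=
  GRing.isAdditive.Build (groupRing G) int augmentation (gr_linB _).

Lemma augmentation_of g : augmentation (gr_of g) = 1.
Proof. exact: gr_lin_of. Qed.
End GroupRingMul.

Lemma gr_multiplicative G (R : nzRingType) (f : {additive groupRing G -> R}) :
  f (gr_of 1%g) = 1 ->
  (forall g h, f (gr_of (g * h)%g) = f (gr_of g) * f (gr_of h)) ->
  monoid_morphism f.
Proof.
move=> f1 fM; split=> // x y.
rewrite {1}[x]gr_of_sum (raddf_gr f x) !mulr_suml raddf_sum.
apply: eq_bigr => g _; rewrite !mulrzAl raddfMz; congr (_ *~ _).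
rewrite {1}[y]gr_of_sum (raddf_gr f y) !mulr_sumr raddf_sum.
apply: eq_bigr => h _; rewrite !mulrzAr raddfMz; congr (_ *~ _).
by rewrite gr_ofM fM.
Qed.

Lemma augmentation_monoid_morphism G : monoid_morphism (@augmentation G).
Proof.
by apply: gr_multiplicative => [|g h]; rewrite /= !augmentation_of ?mulr1.
Qed.

HB.instance Definition _ G :=
  GRing.isMonoidMorphism.Build (groupRing G) int (@augmentation G)
    (augmentation_monoid_morphism G).

Definition augmentation_ideal G : set (groupRing G) :=
  [set x | augmentation x = 0].
Arguments augmentation_ideal : clear implicits.

Definition zspan (V : zmodType) (S : set V) : set V :=
  [set x | exists m (c : 'I_m -> int) (v : 'I_m -> V),
     (forall i, S (v i)) /\ x = \sum_(i < m) v i *~ c i].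

Definition ideal_mul (R : nzRingType) (I J : set R) : set R :=
  zspan [set x * y | x in I & y in J].

Definition ideal_exp (R : nzRingType) (I : set R) (n : nat) : set R :=
  iter n (ideal_mul I) [set: R].

Definition pure_incl k (x : groupRing (pure_braid k)) : groupRing (braid k) :=
  gr_lin (fun b => gr_of (pure_val b)) x.

HB.instance Definition _ k :=
  GRing.isAdditive.Build _ _ (@pure_incl k) (gr_linB _).

Lemma pure_incl_monoid_morphism k : monoid_morphism (@pure_incl k).
Proof.
apply: gr_multiplicative => [|g h]; rewrite /= /pure_incl !gr_lin_of //.
by rewrite gr_ofM.
Qed.

HB.instance Definition _ k :=
  GRing.isMonoidMorphism.Build _ _ (@pure_incl k) (pure_incl_monoid_morphism k).

Lemma pure_incl_inj k : injective (@pure_incl k).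
Proof.
have coef x (b : pure_braid k) : (pure_incl x)@_(pure_val b) = x@_b.
  pose f (x : groupRing (pure_braid k)) : int := (pure_incl x)@_(pure_val b).
  pose g (x : groupRing (pure_braid k)) : int := x@_b.
  have fB : additive f by move=> y z; rewrite /f raddfB mcoeffB.
  have gB : additive g by move=> y z; rewrite /g mcoeffB.
  pose F := HB.pack_for {additive groupRing (pure_braid k) -> int} f
    (GRing.isAdditive.Build _ _ f fB).
  pose H := HB.pack_for {additive groupRing (pure_braid k) -> int} g
    (GRing.isAdditive.Build _ _ g gB).
  apply: (gr_lin_ext (f := F) (h := H)) => c.
  by rewrite /= /f /g /pure_incl gr_lin_of !mcoeffU.
by move=> x y xy; apply/malgP => b; rewrite -!coef xy.
Qed.

(* The diagram w_0 x_0 w_1 x_1 ... x_(n-1) w_n, where w_j is the braid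
   [diag_braid j] and x_j is a double point between the strands at the adjacent
   positions p and p+1, p = [diag_point j]. *)
Record diagram (k n : nat) := Diagram {
  diag_braid : 'I_n.+1 -> braid k;
  diag_point : 'I_n -> 'I_k.-1 }.

Section Diagram.
Variables (k n : nat) (D : diagram k n).

Let before (j : 'I_n) := diag_braid D (widen_ord (leqnSn n) j).
Let final := diag_braid D ord_max.

(* The j-th double point becomes a positive crossing when e j = true, and a
   negative one otherwise. *)
Definition diag_resolve (e : 'I_n -> bool) : braid k :=
  ((\prod_(j < n) (before j *
      (if e j then sigma (diag_point D j) else (sigma (diag_point D j))^-1)))
    * final)%g.

Definition diag_value : groupRing (braid k) :=
  (\prod_(j < n) (gr_of (before j) *
      (gr_of (sigma (diag_point D j)) - gr_of (sigma (diag_point D j))^-1%g)))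
    * gr_of final.

Definition diag_pure : Prop := forall e, diag_resolve e \in @is_pure k.
End Diagram.

(* Main.v *)
Require Import Defs.
From HB Require Import structures.
From mathcomp Require Import all_boot all_fingroup all_algebra.
From mathcomp Require Import finmap monalg.
From mathcomp Require Import boolp classical_sets.
From mathcomp Require Import zify.

(** Modulo the normal closure N of the squares sigma_i^2, the braid group
    satisfies the Coxeter relations of S_k, so a positive word in the first m+1
    generators reduces to h * sigma_m sigma_(m-1) ... sigma_j with h a word in
    the first m generators.  The last strand of a pure braid forces the
    descending part to be empty; by induction on m, N is the whole pure braid
    group.  Since N is generated by a conjugation-stable set of elements
    a = w sigma_i^2 w^-1, the power I^n is spanned by the products
    (a_1 - 1) ... (a_n - 1) r, r pure, and
    w (sigma_i - sigma_i^-1) = (w sigma_i^2 w^-1 - 1) w sigma_i^-1 turns these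
    products into diagrams with n double points and back. *)

Set Implicit Arguments.
Unset Strict Implicit.
Unset Printing Implicit Defensive.

Import GRing.Theory.
Local Open Scope classical_set_scope.
Local Open Scope ring_scope.

(** * Congruence modulo the normal closure of the squared generators *)

Inductive generated (G : groupType) (S : set G) : G -> Prop :=
| generated1 : generated S 1%g
| generatedM g h : generated S g -> generated S h -> generated S (g * h)%g
| generatedV g : generated S g -> generated S g^-1%g
| generated_gen g : S g -> generated S g.

(** The conjugator [w] runs over all braids, not only pure ones, so that these elements generate a
    normal subgroup of the whole braid group. *)
Definition conj_square k : set (braid k) :=
  [set b | exists w i, b = (w * (sigma i * sigma i) * w^-1)%g].

Lemma conj_squareJ k (w b : braid k) :
  conj_square b -> conj_square (w * b * w^-1)%g.
Proof.
by case=> v [i ->]; exists (w * v)%g, i; rewrite invMg !mulgA.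
Qed.

Section SquareClosure.
Variable k : nat.
Implicit Types (b g h w : braid k) (i j m d : nat) (s : seq nat).

Local Notation class u := (pres_class (@braid_rel k) u : braid k).

Lemma braid_classM u v : (class u * class v)%g = class (u ++ v).
Proof. exact: pres_mulE. Qed.

Lemma sigma_far (i j : 'I_k.-1) : (i.+1 < j)%N ->
  (sigma i * sigma j = sigma j * sigma i)%g.
Proof.
by move=> ij; rewrite !braid_classM; apply/pres_classP/pres_rel/braid_far.
Qed.

Lemma sigma_adj (i j : 'I_k.-1) : j = i.+1 :> nat ->
  (sigma i * sigma j * sigma i = sigma j * sigma i * sigma j)%g.
Proof.
move=> ij; rewrite /sigma /pres_gen.
rewrite (braid_classM [:: _] [:: _]) (braid_classM [:: _; _]).
rewrite (braid_classM [:: _] [:: _]) (braid_classM [:: _; _]).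
exact/pres_classP/pres_rel/braid_adj.
Qed.

Local Notation sq_closure := (generated (@conj_square k)).

Lemma sq_conj w b : sq_closure b -> sq_closure (w * b * w^-1)%g.
Proof.
elim=> {b} [|b g _ IHb _ IHg|b _ IHb|b bS].
- by rewrite mulg1 mulgV; exact: generated1.
- have -> : (w * (b * g) * w^-1 = w * b * w^-1 * (w * g * w^-1))%g.
    by rewrite !mulgA mulgKV.
  exact: generatedM.
- have -> : (w * b^-1 * w^-1 = (w * b * w^-1)^-1)%g.
    by rewrite !invMg invgK mulgA.
  exact: generatedV.
- exact/generated_gen/conj_squareJ.
Qed.

(** Equality in the quotient by the normal closure, used without forming that quotient. *)
Definition sq_equiv g h := sq_closure (g * h^-1)%g.

Lemma sq_refl g : sq_equiv g g.
Proof. by rewrite /sq_equiv mulgV; exact: generated1. Qed.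

Lemma sq_trans h g b : sq_equiv g h -> sq_equiv h b -> sq_equiv g b.
Proof.
by move=> gh hb; have := generatedM gh hb; rewrite /sq_equiv mulgA mulgKV.
Qed.

Lemma sq_mulr b g h : sq_equiv g h -> sq_equiv (g * b)%g (h * b)%g.
Proof. by rewrite /sq_equiv invMg mulgA mulgK. Qed.

(** The side that needs normality: [b * g * h^-1 * b^-1] is a conjugate of [g * h^-1]. *)
Lemma sq_mull b g h : sq_equiv g h -> sq_equiv (b * g)%g (b * h)%g.
Proof. by move=> /(sq_conj b); rewrite /sq_equiv invMg !mulgA. Qed.

Lemma braid_permV b : braid_perm b^-1%g = (braid_perm b)^-1%g.
Proof. by apply: (mulgI (braid_perm b)); rewrite -braid_permM !mulgV braid_perm1. Qed.

Lemma braid_perm_sq (i : 'I_k.-1) : braid_perm (sigma i * sigma i)%g = 1%g.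
Proof. by rewrite braid_permM braid_perm_sigma tperm2. Qed.

Lemma braid_perm_conj_sq w (i : 'I_k.-1) :
  braid_perm (w * (sigma i * sigma i) * w^-1)%g = 1%g.
Proof. by rewrite !(braid_permM, braid_permV) -braid_permM braid_perm_sq mulg1 mulgV. Qed.

Lemma generated_perm b : sq_closure b -> braid_perm b = 1%g.
Proof.
elim=> {b} [|b g _ IHb _ IHg|b _ IHb|b bS].
- exact: braid_perm1.
- by rewrite braid_permM IHb IHg mulg1.
- by rewrite braid_permV IHb invg1.
- by case: bS => w [i ->]; exact: braid_perm_conj_sq.
Qed.

Lemma sq_equiv_perm g h : sq_equiv g h -> braid_perm g = braid_perm h.
Proof.
move=> /generated_perm; rewrite braid_permM braid_permV => gh.
by rewrite -[LHS](mulgKV (braid_perm h)) gh mul1g.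
Qed.

(* Equal to 1 when i is out of range. *)
Definition sigma_nat i : braid k := oapp (@sigma k) 1%g (insub i).

Lemma sigma_nat_ord (i : 'I_k.-1) : sigma_nat i = sigma i.
Proof. by rewrite /sigma_nat valK. Qed.

Lemma sigma_nat_far i j : (i.+1 < j)%N ->
  (sigma_nat i * sigma_nat j = sigma_nat j * sigma_nat i)%g.
Proof.
rewrite /sigma_nat; case: insubP => [a _ <-|_ _] /=; last by rewrite mul1g mulg1.
by case: insubP => [b _ <- /sigma_far //|_ _] /=; rewrite mul1g mulg1.
Qed.

Lemma sigma_nat_adj i : (i.+1 < k.-1)%N ->
  (sigma_nat i * sigma_nat i.+1 * sigma_nat i =
   sigma_nat i.+1 * sigma_nat i * sigma_nat i.+1)%g.
Proof.
move=> lt_i; rewrite -[i.+1]/(val (Ordinal lt_i)) -[i]/(val (Ordinal (ltnW lt_i))).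
by rewrite !sigma_nat_ord sigma_adj.
Qed.

Lemma sigma_nat_sq i : sq_equiv (sigma_nat i * sigma_nat i)%g 1%g.
Proof.
rewrite /sq_equiv /sigma_nat; case: insubP => [a _ _|_] /=.
  apply: generated_gen; exists 1%g, a; by rewrite mul1g.
by rewrite invg1 !mulg1; exact: generated1.
Qed.

Lemma sigma_nat_perm i (x : 'I_k) : (i < k.-1)%N ->
  braid_perm (sigma_nat i) x =
    (if x == i :> nat then i.+1 else if x == i.+1 :> nat then i : nat else x)
  :> nat.
Proof.
move=> lt_i; rewrite -[i]/(val (Ordinal lt_i)) sigma_nat_ord braid_perm_sigma.
exact: val_tperm_strand.
Qed.

(** * Coxeter normal form of positive words *)

Definition braid_of s : braid k := (\prod_(i <- s) sigma_nat i)%g.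

Lemma braid_of_rcons s i : braid_of (rcons s i) = (braid_of s * sigma_nat i)%g.
Proof. by rewrite /braid_of -cats1 big_cat /= big_cons big_nil mulg1. Qed.

(* desc j d is the product of the d generators of indices j + d - 1, ..., j. *)
Fixpoint desc j d : braid k :=
  if d is d'.+1 then (sigma_nat (j + d') * desc j d')%g else 1%g.

Lemma descSr j d : desc j d.+1 = (desc j.+1 d * sigma_nat j)%g.
Proof.
elim: d => [|d IHd]; first by rewrite /= addn0 mul1g mulg1.
by rewrite -[LHS]/(sigma_nat _ * desc j d.+1)%g IHd mulgA /= addSnnS.
Qed.

Lemma desc_far_l j d i : (i.+1 < j)%N ->
  (desc j d * sigma_nat i = sigma_nat i * desc j d)%g.
Proof.
move=> ij; elim: d => [|d IHd] /=; first by rewrite mul1g mulg1.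
by rewrite -mulgA IHd mulgA -sigma_nat_far ?mulgA //; lia.
Qed.

Lemma desc_far_r j d i : (j + d <= i)%N ->
  (desc j d * sigma_nat i.+1 = sigma_nat i.+1 * desc j d)%g.
Proof.
elim: d => [|d IHd] /= ij; first by rewrite mul1g mulg1.
rewrite -mulgA IHd; last by lia.
by rewrite mulgA sigma_nat_far ?mulgA //; lia.
Qed.

(** [sigma_nat i.+1] commutes leftwards up to the factors of index [i + 1] and [i]. There the braid
    relation trades it for a [sigma_nat i] on their left, which commutes with all factors of larger
    index. *)
Lemma desc_shift j d i : (j + d <= k.-1)%N -> (j <= i)%N -> (i.+1 < j + d)%N ->
  (desc j d * sigma_nat i.+1 = sigma_nat i * desc j d)%g.
Proof.
elim: d => [|d IHd] /= jd ji ijd; first by lia.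
case: (ltnP i.+1 (j + d)) => id.
  rewrite -mulgA IHd //; last by lia.
  by rewrite !mulgA -(sigma_nat_far id).
case: d jd ijd id {IHd} => [|d] jd ijd id /=; first by lia.
have -> : (j + d.+1)%N = i.+1 by lia.
have -> : (j + d)%N = i by lia.
rewrite -!mulgA desc_far_r; last by lia.
by rewrite !mulgA sigma_nat_adj //; lia.
Qed.

(** Induction on the last letter [i], which is pushed into the descending part of indices [m] down
    to [j]. Only the cancellation of a square replaces equality by equivalence. *)
Lemma coxeter_normal_form m s : (m < k.-1)%N -> all (fun i => i < m.+1)%N s ->
  exists (h : seq nat) j d, [/\ all (fun i => i < m)%N h, (j + d = m.+1)%N &
    sq_equiv (braid_of s) (braid_of h * desc j d)%g].
Proof.
move=> lt_m; elim/last_ind: s => [_|s i IHs].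
  exists [::], m.+1, 0%N; split=> //; first by rewrite addn0.
  by rewrite mulg1; exact: sq_refl.
rewrite all_rcons => /andP[lt_i /IHs[h [j [d [hm jd eqv]]]]].
have {}eqv := sq_mulr (sigma_nat i) eqv.
rewrite -braid_of_rcons -mulgA in eqv.
have [ij|ji|ij] := ltngtP i j; last 1 first.
(* For [i = j] the square cancels and the descending part loses its last factor. *)
- case: d jd eqv => [|d] jd eqv; first by lia.
  exists h, j.+1, d; split=> //; first by lia.
  apply: sq_trans eqv _; apply: sq_mull.
  rewrite descSr ij -mulgA -[X in sq_equiv _ X]mulg1.
  exact/sq_mull/sigma_nat_sq.
(* For [i + 1 < j] the letter commutes past the descending part; for [i + 1 = j] it prolongs it. *)
- have [ij'|ij'] : (i.+1 < j)%N \/ j = i.+1 by lia.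
    exists (rcons h i), j, d; split=> //; first by rewrite all_rcons hm; lia.
    by rewrite (braid_of_rcons h) -mulgA -desc_far_l.
  exists h, i, d.+1; split=> //; first by lia.
  by rewrite descSr -ij'.
(* For [i > j] the letter crosses the descending part and comes out as [i - 1], which is below
   [m]. *)
- case: i ji lt_i eqv => [|i] ji lt_i eqv; first by lia.
  exists (rcons h i), j, d; split=> //; first by rewrite all_rcons hm; lia.
  by rewrite (braid_of_rcons h) -mulgA -desc_shift //; lia.
Qed.

(** * Permutations of normal forms and generation of the pure braid group *)

Lemma braid_of_perm_fix m s (x : 'I_k) : (m <= k.-1)%N ->
  all (fun i => i < m)%N s -> (m < x)%N -> braid_perm (braid_of s) x = x.
Proof.
move=> lt_m sm mx; elim/last_ind: s sm => [_|s i IHs].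
  by rewrite /braid_of big_nil braid_perm1 perm1.
rewrite all_rcons braid_of_rcons braid_permM permM => /andP[im /IHs ->].
apply: val_inj; rewrite /= sigma_nat_perm; last by lia.
by do !case: ifPn; lia.
Qed.

Lemma desc_perm j d (x : 'I_k) : (j + d <= k.-1)%N -> x = (j + d)%N :> nat ->
  braid_perm (desc j d) x = j :> nat.
Proof.
elim: d x => [|d IHd] x jd xE /=; first by rewrite braid_perm1 perm1 xE addn0.
rewrite braid_permM permM IHd //; first by lia.
rewrite sigma_nat_perm; last by lia.
by do !case: ifPn; lia.
Qed.

Lemma pure_braid_of m s : (m <= k.-1)%N -> all (fun i => i < m)%N s ->
  braid_perm (braid_of s) = 1%g -> sq_closure (braid_of s).
Proof.
elim: m s => [|m IHm] s lt_m sm ps.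
  case: s sm {ps} => [_|//]; rewrite /braid_of big_nil; exact: generated1.
have [h [j [d [hm jd eqv]]]] := coxeter_normal_form lt_m sm.
have lt_mk : (m.+1 < k)%N by lia.
have := sq_equiv_perm eqv; rewrite ps braid_permM => hd.
(* Read on strand [m + 1]: [h] fixes it and the descending part sends it to [j], so purity gives
   [j = m + 1]. *)
have d0 : d = 0%N.
  have /(congr1 val) := congr1 (fun p : 'S_k => p (Ordinal lt_mk)) hd.
  rewrite perm1 permM (braid_of_perm_fix (ltnW lt_m) hm) //=.
  by rewrite desc_perm /=; lia.
rewrite d0 /= braid_perm1 mulg1 in hd.
have := eqv; rewrite d0 /= mulg1 => {}eqv.
have := generatedM eqv (IHm h (ltnW lt_m) hm (esym hd)).
by rewrite mulgKV.
Qed.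

Lemma sigma_inv_equiv (i : 'I_k.-1) : sq_equiv (sigma i)^-1%g (sigma i).
Proof.
rewrite /sq_equiv -invMg; apply/generatedV/generated_gen.
by exists 1%g, i; rewrite mul1g invg1 mulg1.
Qed.

Lemma braid_positive b : exists2 s, all (fun i => i < k.-1)%N s &
  sq_equiv b (braid_of s).
Proof.
rewrite -(pres_reprK b).
elim: (generic_quotient.repr b) => [|[i e] u [s sk eqv]].
  by exists [::] => //; rewrite /braid_of big_nil; exact: sq_refl.
exists (nat_of_ord i :: s); first by rewrite /= ltn_ord.
rewrite /braid_of big_cons sigma_nat_ord -/(braid_of s).
have -> : class ((i, e) :: u) =
    ((if e then sigma i else (sigma i)^-1) * class u)%g.
  rewrite -cat1s -braid_classM; case: e => //; congr (_ * _)%g.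
  exact/esym/pres_invE.
apply: sq_trans (sq_mull _ eqv).
by apply: sq_mulr; case: e; [exact: sq_refl | exact: sigma_inv_equiv].
Qed.

Theorem pure_generated b : braid_perm b = 1%g -> sq_closure b.
Proof.
have [s sk eqv] := braid_positive b => pb.
have := generatedM eqv (pure_braid_of (leqnn _) sk _).
by rewrite mulgKV; apply; rewrite -(sq_equiv_perm eqv).
Qed.

End SquareClosure.

(** * Additive subgroups and integer spans *)

Lemma sumrB_mulrz (V : zmodType) (J : Type) (r : seq J) (F : J -> V) v c :
  \sum_(j <- r) (F j - v) *~ c j =
  \sum_(j <- r) F j *~ c j - v *~ \sum_(j <- r) c j.
Proof. by rewrite mulrz_sumr -sumrB; apply: eq_bigr => j _; rewrite mulrzBl. Qed.

Section IntegerSpan.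

Definition subgroup_set (V : zmodType) (P : set V) :=
  P 0 /\ forall x y, P x -> P y -> P (x - y).

Lemma subgroup_set_preimage (U V : zmodType) (f : U -> V) (P : set V) :
  {morph f : x y / x - y} -> subgroup_set P -> subgroup_set [set x | P (f x)].
Proof.
move=> fB [P0 PB]; split=> [|x y] /=; first by rewrite -(subrr 0) fB subrr.
by rewrite fB; exact: PB.
Qed.

Variable V : zmodType.
Implicit Types (S P : set V) (v : V).

Lemma subgroup_setN P v : subgroup_set P -> P v -> P (- v).
Proof. by case=> P0 PB Pv; rewrite -sub0r; exact: PB. Qed.

Lemma subgroup_setD P v w : subgroup_set P -> P v -> P w -> P (v + w).
Proof.
by move=> sP Pv /(subgroup_setN sP) Pw; rewrite -[w]opprK; exact: sP.2.
Qed.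

Lemma zspan_gen S : S `<=` zspan S.
Proof.
move=> v Sv; exists 1%N, (fun=> 1), (fun=> v); split=> //.
by rewrite big_ord1 mulr1z.
Qed.

Lemma zspan_subgroup S : subgroup_set (zspan S).
Proof.
split.
  by exists 0%N, (fun=> 0), (fun=> 0); split=> [[]//|]; rewrite big_ord0.
move=> _ _ [m [c [v [Sv ->]]]] [p [d [u [Su ->]]]].
exists (m + p)%N, (fun i => match split i with inl i => c i | inr i => - d i end),
  (fun i => match split i with inl i => v i | inr i => u i end).
split=> [i|]; first by case: (split i).
rewrite big_split_ord /= -sumrN; congr (_ + _); apply: eq_bigr => i _.
  by rewrite -[lshift p i]/(unsplit (inl i)) unsplitK.
by rewrite -[rshift m i]/(unsplit (inr i)) unsplitK mulrNz.
Qed.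

Lemma zspan_min S P : subgroup_set P -> S `<=` P -> zspan S `<=` P.
Proof.
move=> sP SP _ [m [c [v [Sv ->]]]].
elim/big_ind: _ => [|x y|i _]; [exact: sP.1 | exact: subgroup_setD |].
have PM q : P (v i *+ q).
  elim: q => [|q IHq]; first exact: sP.1.
  by rewrite mulrS; apply: subgroup_setD IHq => //; exact: SP.
by case: (c i) => q; rewrite -?pmulrn ?NegzE ?mulrNz; [|apply: subgroup_setN];
  rewrite // -?pmulrn; exact: PM.
Qed.

Lemma zspanS S P : S `<=` zspan P -> zspan S `<=` zspan P.
Proof. by apply: zspan_min; exact: zspan_subgroup. Qed.

Lemma zspan_sum (J : Type) (r : seq J) (F : J -> V) (c : J -> int) S :
  (forall j, zspan S (F j)) -> zspan S (\sum_(j <- r) F j *~ c j).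
Proof.
move=> SF; apply: (@zspan_min (range F)); first exact: zspan_subgroup.
  by move=> _ [j _ <-].
exists (size r), (fun j => c (tnth (in_tuple r) j)),
  (fun j => F (tnth (in_tuple r) j)).
by split=> [j|]; [exists (tnth (in_tuple r) j) | rewrite [LHS]big_tnth].
Qed.

End IntegerSpan.

(** Both inclusions follow from minimality of spans: preimages and images of subgroups under [f] are
    subgroups. *)
Lemma zspan_image (U V : zmodType) (f : {additive U -> V}) (S : set U) :
  f @` zspan S = zspan (f @` S).
Proof.
apply/seteqP; split.
  move=> _ [x Sx <-].
  apply: (zspan_min (subgroup_set_preimage (raddfB f) (zspan_subgroup (f @` S)))) Sx.
  by move=> y Sy; apply: zspan_gen; exists y.
have [S0 SB] := zspan_subgroup S.
apply: zspan_min; last by move=> _ [x Sx <-]; exists x => //; exact: zspan_gen.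
split; first by exists 0; rewrite ?raddf0.
by move=> _ _ [x Sx <-] [y Sy <-]; exists (x - y); rewrite ?raddfB //; exact: SB.
Qed.

(** * Powers of an augmentation ideal, from generators stable under conjugation *)

Section AugmentationPowers.
Variables (G : groupType) (S : set G).
Implicit Types (g h r a : G) (x y : groupRing G) (n : nat).

Lemma gr_of1 : gr_of (1%g : G) = 1.
Proof. by []. Qed.

(** The final group element [r] is a parameter because in the braid group purity becomes a condition
    on [r] alone, the factors [a] being pure. *)
Fixpoint aug_products r n : set (groupRing G) :=
  if n is n'.+1 then [set (gr_of a - 1) * y | a in S & y in aug_products r n']
  else [set gr_of r].

Hypothesis SJ : forall g a, S a -> S (g * a * g^-1)%g.

(** By [g (a - 1) = (g a g^-1 - 1) g], the element [g] travels through the factors and is absorbed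
    by [r]. *)
Lemma aug_products_mull g r n y :
  aug_products r n y -> aug_products (g * r)%g n (gr_of g * y).
Proof.
elim: n r y => [|n IHn] r y /=; first by move->; rewrite gr_ofM.
case=> a Sa [z rz <-]; exists (g * a * g^-1)%g; first exact: SJ.
exists (gr_of g * z); first exact: IHn.
rewrite mulrA mulrBl gr_ofM mulgKV mul1r mulrA mulrBr gr_ofM mulr1.
by [].
Qed.

Hypothesis Sgen : forall g, generated S g.

Definition aug_span n := zspan [set x | exists r, aug_products r n x].

(** Uses [gh - 1 = (g - 1) h + (h - 1)] and [g^-1 - 1 = - (g - 1) g^-1]. The stray [h] or [g^-1] is
    moved into [r], hence [r] and [y] stay general in the induction. *)
Lemma aug_products_aug_span g r n y :
  aug_products r n y -> aug_span n.+1 ((gr_of g - 1) * y).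
Proof.
have sP : subgroup_set (aug_span n.+1) by exact: zspan_subgroup.
elim: {g}(Sgen g) r y => [|g h _ IHg _ IHh|g _ IHg|g Sg] r y ry.
- by rewrite gr_of1 subrr mul0r; exact: sP.1.
- have -> : (gr_of (g * h)%g - 1) * y =
     (gr_of g - 1) * (gr_of h * y) + (gr_of h - 1) * y.
    by rewrite !mulrBl !mul1r mulrA gr_ofM addrA subrK.
  apply: (subgroup_setD sP); last exact: IHh ry.
  exact: IHg (aug_products_mull h ry).
- have -> : (gr_of g^-1%g - 1) * y = - ((gr_of g - 1) * (gr_of g^-1%g * y)).
    by rewrite !mulrBl mulrA gr_ofM mulgV gr_of1 !mul1r opprB.
  apply: (subgroup_setN sP).
  exact: IHg (aug_products_mull g^-1%g ry).
- by apply: zspan_gen; exists r, g => //; exists y.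
Qed.

Lemma aug_span_mull g n y : aug_span n y -> aug_span n.+1 ((gr_of g - 1) * y).
Proof.
move: y; apply: (zspan_min (P := [set y | aug_span n.+1 ((gr_of g - 1) * y)])).
  exact: (subgroup_set_preimage (mulrBr _) (zspan_subgroup _)).
by move=> y [r]; exact: aug_products_aug_span.
Qed.

(** The coefficients sum to zero, so replacing each [g] by [g - 1] subtracts nothing. *)
Lemma augmentation_idealE x : augmentation_ideal G x ->
  x = \sum_(g <- msupp x) (gr_of g - 1) *~ x@_g.
Proof.
rewrite /augmentation_ideal /= => x0.
have {}x0 : \sum_(g <- msupp x) x@_g = 0.
  by rewrite -[RHS]x0; apply: eq_bigr => g _; rewrite intz.
by rewrite sumrB_mulrz x0 mulr0z subr0 -gr_of_sum.
Qed.

Lemma ideal_exp_augmentation n :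
  ideal_exp (augmentation_ideal G) n = aug_span n.
Proof.
elim: n => [|n IHn].
  (* The zeroth power is the whole ring, spanned by the group elements, which are the products
     without factors. *)
  apply/seteqP; split=> // x _; rewrite [x]gr_of_sum.
  by apply: zspan_sum => g; apply: zspan_gen; exists g.
rewrite /ideal_exp iterS -/(ideal_exp _ n) IHn; apply/seteqP; split.
  apply: zspanS => _ [x Ix [y ny <-]].
  rewrite (augmentation_idealE Ix) mulr_suml.
  under eq_bigr do rewrite mulrzAl.
  by apply: zspan_sum => g; exact: aug_span_mull.
apply: zspanS => _ [r [a Sa [y ry <-]]].
apply: zspan_gen; exists (gr_of a - 1).
  by rewrite /augmentation_ideal /= raddfB /= rmorph1 augmentation_of subrr.
by exists y => //; apply: zspan_gen; exists r.
Qed.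

End AugmentationPowers.

(** * Translation between diagrams and products *)

(** Stated for any monoid law, to peel the first double point off both the value of a diagram in the
    group ring and its resolutions in the braid group. *)
Lemma big_interleave_recl (T : Type) (idx : T) (op : Monoid.law idx) n
    (a : 'I_n.+2 -> T) (x : 'I_n.+1 -> T) :
  op (\big[op/idx]_(j < n.+1) op (a (widen_ord (leqnSn n.+1) j)) (x j))
     (a ord_max) =
  op (op (a ord0) (x ord0))
     (op (\big[op/idx]_(j < n)
            op (a (lift ord0 (widen_ord (leqnSn n) j))) (x (lift ord0 j)))
         (a (lift ord0 ord_max))).
Proof.
rewrite big_ord_recl -!Monoid.mulmA.
congr (op (a _) (op _ (op _ (a _)))); try exact: val_inj.
by apply: eq_bigr => j _; congr (op (a _) _); exact: val_inj.
Qed.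

Section MultiplicativeMap.
Variables (G : groupType) (A : nzRingType) (f : G -> A).
Hypothesis fM : forall g h, f g * f h = f (g * h)%g.
Implicit Types g h s w : G.

Lemma map_double_point w s :
  f w * (f s - f s^-1%g) = (f (w * (s * s) * w^-1)%g - 1) * f (w * s^-1)%g.
Proof. by rewrite mulrBl mul1r mulrBr !fM !mulgA mulgKV mulgK. Qed.

(** The converse exchange: since [(s - s^-1) s w^-1 = (s^2 - 1) w^-1], a factor [s w^-1] is handed
    to what follows the double point. *)
Lemma map_conj_double_point g w s y :
  f (g * w)%g * (f s - f s^-1%g) * (f (s * w^-1)%g * y) =
  f g * ((f (w * (s * s) * w^-1)%g - 1) * y).
Proof.
rewrite !mulrA; congr (_ * _).
by rewrite !mulrBr !mulrBl mulr1 !fM !mulgA mulgKV mulgK.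
Qed.

End MultiplicativeMap.

Section Diagrams.
Variable k : nat.

Definition diag_cons n (b : braid k) (i : 'I_k.-1) (D : diagram k n) :
    diagram k n.+1 :=
  Diagram (fun j => oapp (diag_braid D) b (unlift ord0 j))
          (fun j => oapp (diag_point D) i (unlift ord0 j)).

Definition diag_behead n (D : diagram k n.+1) : diagram k n :=
  Diagram (fun j => diag_braid D (lift ord0 j))
          (fun j => diag_point D (lift ord0 j)).

Lemma diag_consK n b i : cancel (@diag_cons n b i) (@diag_behead n).
Proof.
case=> f p; rewrite /diag_behead /=.
by congr Diagram; apply/funext => j; rewrite liftK.
Qed.

Lemma diag_value_recl n (D : diagram k n.+1) :
  let s := sigma (diag_point D ord0) in
  diag_value D =
    gr_of (diag_braid D ord0) * (gr_of s - gr_of s^-1%g) *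
    diag_value (diag_behead D).
Proof.
exact: (big_interleave_recl *%R (fun j => gr_of (diag_braid D j))
  (fun j => gr_of (sigma (diag_point D j)) - gr_of (sigma (diag_point D j))^-1%g)).
Qed.

Lemma diag_resolve_recl n (D : diagram k n.+1) e :
  let s := sigma (diag_point D ord0) in
  diag_resolve D e =
    (diag_braid D ord0 * (if e ord0 then s else s^-1) *
     diag_resolve (diag_behead D) (fun j => e (lift ord0 j)))%g.
Proof.
exact: (big_interleave_recl *%g (diag_braid D) (fun j =>
  if e j then sigma (diag_point D j) else (sigma (diag_point D j))^-1%g)).
Qed.

Local Notation sq_products := (aug_products (@conj_square k)).

(* From s - s^-1 = (s^2 - 1) s^-1: the braid on the right resolves every
   double point negatively. *)
Lemma diag_value_products n (D : diagram k n) :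
  sq_products (diag_resolve D (fun=> false)) n (diag_value D).
Proof.
elim: n D => [|n IHn] D.
  by rewrite /= /diag_value /diag_resolve !big_ord0 mul1r mul1g.
rewrite diag_value_recl diag_resolve_recl /=.
set b := diag_braid D ord0; set s := sigma _.
exists (b * (s * s) * b^-1)%g; first by exists b, (diag_point D ord0).
exists (gr_of (b * s^-1)%g * diag_value (diag_behead D)).
  exact/aug_products_mull/IHn/conj_squareJ.
by rewrite mulrA (map_double_point (@gr_ofM _)).
Qed.

(** The prefix [g] carries the braid handed over by the preceding double point. Fixing the
    permutation of every resolution makes the diagram pure as soon as [g * r] is. *)
Lemma products_diag_value n (g r : braid k) v : sq_products r n v ->
  exists2 D : diagram k n, diag_value D = gr_of g * v &
    forall e, braid_perm (diag_resolve D e) = braid_perm (g * r)%g.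
Proof.
elim: n g v => [|n IHn] g v /=.
  (* ['I_k.-1] may be empty, so the family of no double points is built by elimination. *)
  have no_point (j : 'I_0) : 'I_k.-1 by case: j.
  move->; exists (Diagram (fun=> (g * r)%g) no_point).
    by rewrite /diag_value big_ord0 mul1r gr_ofM.
  by move=> e; rewrite /diag_resolve big_ord0 mul1g.
case=> _ [w [i ->]] [y /(IHn (sigma i * w^-1)%g)[D Dy Dr] <-].
exists (diag_cons (g * w)%g i D).
  rewrite diag_value_recl diag_consK /= !unlift_none /= Dy.
  exact: (map_conj_double_point (f := @gr_of (braid k)) (@gr_ofM (braid k)) g w (sigma i) y).
move=> e; rewrite diag_resolve_recl diag_consK /= !unlift_none /=.
rewrite braid_permM Dr -braid_permM.
set s := sigma i.
(* Resolving the first point gives [g * r] preceded by a conjugate of [s * s] or of [1], which has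
   trivial permutation. *)
have -> : (g * w * (if e ord0 then s else s^-1) * (s * w^-1 * r) =
  (g * w) * ((if e ord0 then s else s^-1) * s) * (g * w)^-1 * (g * r))%g.
  by rewrite invMg !mulgA mulgKV.
rewrite braid_permM; set c := (X in braid_perm X).
suff -> : braid_perm c = 1%g by rewrite mul1g.
rewrite {}/c; case: (e ord0); first exact: braid_perm_conj_sq.
by rewrite mulVg mulg1 mulgV braid_perm1.
Qed.

End Diagrams.

Lemma rmorph_subr1M (A B : nzRingType) (f : {rmorphism A -> B}) x y :
  f ((x - 1) * y) = (f x - 1) * f y.
Proof. by rewrite rmorphM rmorphB rmorph1. Qed.

(** * Lifting to the pure braid group, and conclusion *)

Section PureBraids.
Variable k : nat.

Let pure_square : set (pure_braid k) := [set p | conj_square (pure_val p)].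

Lemma pure_squareJ p q : pure_square q -> pure_square (p * q * p^-1)%g.
Proof. exact: (@conj_squareJ k (pure_val p) (pure_val q)). Qed.

(** A derivation in the braid group lifts step by step: by [generated_perm] each intermediate
    element is itself pure. *)
Lemma pure_square_generated p : generated pure_square p.
Proof.
have pureP b : braid_perm b = 1%g -> b \in @is_pure k by move/eqP.
suff gen b : generated (@conj_square k) b ->
    forall q, pure_val q = b -> generated pure_square q.
  by apply: gen (erefl _); apply/pure_generated/eqP; exact: (valP p).
elim=> {b p} [|b c gb IHb gc IHc|b gb IHb|b Sb] p pE.
- have -> : p = 1%g by exact: val_inj.
  exact: generated1.
- pose B := PureBraid (pureP _ (generated_perm gb)).
  pose C := PureBraid (pureP _ (generated_perm gc)).
  have -> : p = (B * C)%g by exact: val_inj.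
  by apply: generatedM; [exact: IHb | exact: IHc].
- pose B := PureBraid (pureP _ (generated_perm gb)).
  have -> : p = B^-1%g by exact: val_inj.
  by apply: generatedV; exact: IHb.
- by apply: generated_gen; rewrite /pure_square /= pE.
Qed.

Lemma pure_incl_of (p : pure_braid k) :
  pure_incl (gr_of p) = gr_of (pure_val p).
Proof. exact: gr_lin_of. Qed.

Lemma pure_incl_subr1M (p : pure_braid k) y :
  pure_incl ((gr_of p - 1) * y) = (gr_of (pure_val p) - 1) * pure_incl y.
Proof. by rewrite -pure_incl_of; exact: rmorph_subr1M. Qed.

Lemma pure_incl_products r n :
  @pure_incl k @` aug_products pure_square r n =
  aug_products (@conj_square k) (pure_val r) n.
Proof.
elim: n => [|n IHn] /=; first by rewrite image_set1 pure_incl_of.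
apply/seteqP; split.
  move=> _ [_ [p Sp [y ry <-]] <-]; exists (pure_val p) => //.
  exists (pure_incl y); first by rewrite -IHn; exists y.
  by rewrite pure_incl_subr1M.
move=> _ [b Sb [z rz <-]]; move: rz; rewrite -IHn => -[y ry <-].
have pb : b \in @is_pure k.
  by apply/eqP; case: Sb => w [i ->]; exact: braid_perm_conj_sq.
exists ((gr_of (PureBraid pb) - 1) * y).
  by exists (PureBraid pb) => //; exists y.
by rewrite pure_incl_subr1M.
Qed.

(** Inside the ring of the full braid group, purity remains as a condition on the trailing braid
    [b], since conjugated squares are pure. *)
Lemma pure_incl_ideal_exp n :
  @pure_incl k @` ideal_exp (augmentation_ideal (pure_braid k)) n =
  zspan [set v | exists2 b : braid k, braid_perm b = 1%g &
                  aug_products (@conj_square k) b n v].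
Proof.
rewrite (ideal_exp_augmentation pure_squareJ pure_square_generated).
rewrite /aug_span zspan_image; congr zspan; apply/seteqP; split.
  move=> _ [x [r rx] <-]; exists (pure_val r); first exact/eqP/(valP r).
  by rewrite -pure_incl_products; exists x.
move=> v [b pb]; have pb' : b \in @is_pure k by exact/eqP.
rewrite -[b]/(pure_val (PureBraid pb')) -pure_incl_products => -[x bx <-].
by exists x => //; exists (PureBraid pb').
Qed.

End PureBraids.

Theorem proposition2p13 (k n : nat) (hk : (1 <= k)%N) (hn : (1 <= n)%N) :
  [set pure_incl x | x in ideal_exp (augmentation_ideal (pure_braid k)) n] =
  zspan [set diag_value D | D in [set D : diagram k n | diag_pure D]].
Proof.
rewrite pure_incl_ideal_exp; congr zspan; apply/seteqP; split.
  move=> v [b pb /(products_diag_value 1%g)[D Dv Db]].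
  exists D; last by rewrite Dv gr_of1 mul1r.
  by move=> e; apply/eqP; rewrite Db mul1g.
(* The trailing braid is the all-negative resolution, pure like every resolution of [D]. *)
move=> _ [D pD <-]; exists (diag_resolve D (fun=> false)).
  exact/eqP/pD.
exact: diag_value_products.
Qed.
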